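(* Let $l=1+l_1x_1+\dots+l_nx_n\in R_{\le 1}$ and $g=1+g_1x_1+\dots+g_nx_n\in R_{\le 1}$. For every integer $d\ge 1$ we have the equality $$\tau(l^{d-1}g)=\mathbf 1_l+\frac1d\,\mathbf 1_l\circ\left[\sum_{i=1}^n(g_i-l_i)\frac{\partial}{\partial x_i}\right]$$ in $R_{\le d}^*$, where $\mathbf 1_l$ denotes evaluation at the point $(l_1,\dots,l_n)$.
   Context: $\mathbb K$ is an algebraically closed field of characteristic $0$, $n\ge1$, $R=\mathbb K[x_1,\dots,x_n]$, and $R_{\le d}$ is the space of polynomials of total degree at most $d$. For $\alpha\in\mathbb N^n$ with $|\alpha|\le d$ put $\binom{d}{\alpha}=\frac{d!}{\alpha_1!\cdots\alpha_n!\,(d-|\alpha|)!}$. The apolar product on $R_{\le d}$ is $\langle\sum_{|\alpha|\le d} f_\alpha\mathbf x^\alpha,\sum_{|\alpha|\le d} g_\alpha\mathbf x^\alpha\rangle=\sum_{|\alpha|\le d}f_\alpha g_\alpha/\binom{d}{\alpha}$. The dual map $\tau:R_{\le d}\to R_{\le d}^*$ sends $f$ to $f^*=(g\mapsto\langle f,g\rangle)$. For $l=1+l_1x_1+\dots+l_nx_n$, $\mathbf 1_l(f)=f(l_1,\dots,l_n)$. *)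

(* Defs.v *)
From HB Require Import structures.
From mathcomp Require Import all_boot all_algebra.
From mathcomp.multinomials Require Export mpoly.

Set Implicit Arguments.
Unset Strict Implicit.
Unset Printing Implicit Defensive.

Import GRing.Theory.
Local Open Scope ring_scope.

(* In multinomials, [msize p] is 1 + the total degree of p, and 0 if p = 0. *)
Section BoundedDegree.
Context (n : nat) (K : fieldType) (d : nat).

Definition deg_le_pred : pred {mpoly K[n]} := fun p => (msize p <= d.+1)%N.

Lemma deg_le_submod_closed : submod_closed deg_le_pred.
Proof.
split=> [|c p q]; rewrite !unfold_in /deg_le_pred ?msize0 //= => hp hq.
apply: leq_trans (msizeD_le _ _) _.
by rewrite geq_max hq andbT; apply: leq_trans (msizeZ_le _ _) hp.
Qed.

HB.instance Definition _ :=
  GRing.isSubmodClosed.Build K {mpoly K[n]} deg_le_pred deg_le_submod_closed.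

Definition deg_le : qualifier 0 {mpoly K[n]} := [qualify p | deg_le_pred p].

Record polyle :=
  PolyLe { mpoly_of_polyle :> {mpoly K[n]}; _ : mpoly_of_polyle \is deg_le }.

HB.instance Definition _ := [isSub for mpoly_of_polyle].
HB.instance Definition _ := [Choice of polyle by <:].
HB.instance Definition _ := [SubChoice_isSubLmodule of polyle by <:].

Lemma polyle_size (f : polyle) : (msize (f : {mpoly K[n]}) <= d.+1)%N.
Proof. by case: f. Qed.

Lemma polyle_vecaxiom : Vector.axiom #|{: 'X_{1..n < d.+1}}| polyle.
Proof.
pose F (f : polyle) : 'rV[K]_#|{: 'X_{1..n < d.+1}}| :=
  \row_i (f : {mpoly K[n]})@_(enum_val i : 'X_{1..n < d.+1}).
exists F.
  by move=> c p q; apply/rowP=> i; rewrite !mxE /= mcoeffD mcoeffZ.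
pose g (r : 'rV[K]_#|{: 'X_{1..n < d.+1}}|) : {mpoly K[n]} :=
  \sum_(m : 'X_{1..n < d.+1}) r 0 (enum_rank m) *: 'X_[m].
have hg r : g r \is deg_le.
  apply: rpred_sum => m _; apply: rpredZ.
  by rewrite unfold_in /deg_le_pred msizeX ltnS -ltnS bmdeg.
exists (fun r => PolyLe (hg r)) => [f|r].
  apply/val_inj => /=; rewrite /g [RHS](mpolywE (k := d.+1)) ?polyle_size //.
  by apply: eq_bigr => m _; rewrite mxE enum_rankK.
apply/rowP=> i; rewrite mxE /= /g raddf_sum (bigD1 (enum_val i)) //=.
rewrite mcoeffZ mcoeffX eqxx mulr1 enum_valK big1 ?addr0 // => m ne.
by rewrite mcoeffZ mcoeffX (_ : (_ == _) = false) ?mulr0 //; apply/negbTE.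
Qed.

HB.instance Definition _ := Lmodule_hasFinDim.Build K polyle polyle_vecaxiom.

End BoundedDegree.

Section Apolar.
Context (n : nat) (K : fieldType) (d : nat).
Implicit Types (f g : polyle n K d).

(* Meant for [mdeg a <= d], where the truncated subtraction is exact. *)
Definition multibinom (a : 'X_{1..n}) : K :=
  d`!%:R / ((\prod_(i < n) (a i)`!) * (d - mdeg a)`!)%N%:R.

Definition apolar f g : K^o :=
  \sum_(a : 'X_{1..n < d.+1})
    (f : {mpoly K[n]})@_a * (g : {mpoly K[n]})@_a / multibinom a.

Lemma apolar_is_linear f : linear (apolar f).
Proof.
move=> c p q; rewrite /apolar scaler_sumr -big_split /=.
apply: eq_bigr => a _; rewrite mcoeffD mcoeffZ mulrDr mulrDl.
by rewrite /GRing.scale /= !mulrA [_ * c]mulrC.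
Qed.

HB.instance Definition _ f :=
  GRing.isLinear.Build K (polyle n K d) K^o _ (apolar f) (apolar_is_linear f).

Definition tau f : 'Hom(polyle n K d, K^o) := linfun (apolar f).

Definition evalp (l : 'I_n -> K) f : K^o := (f : {mpoly K[n]}).@[l].

Lemma evalp_is_linear l : linear (evalp l).
Proof. by move=> c p q; rewrite /evalp /= mevalD mevalZ. Qed.

HB.instance Definition _ l :=
  GRing.isLinear.Build K (polyle n K d) K^o _ (evalp l) (evalp_is_linear l).

Definition eval_at l : 'Hom(polyle n K d, K^o) := linfun (evalp l).

Lemma mderiv_le (i : 'I_n) f : (f : {mpoly K[n]})^`M(i) \is deg_le n K d.
Proof.
rewrite (mderivwE i (polyle_size f)).
apply: rpred_sum => m _; apply: rpredZ.
rewrite unfold_in /deg_le_pred msizeX ltnS (leq_trans (mdegB _ _)) //.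
by rewrite -ltnS bmdeg.
Qed.

Definition derivp (i : 'I_n) f : polyle n K d := PolyLe (mderiv_le i f).

Lemma derivp_is_linear i : linear (derivp i).
Proof. by move=> c p q; apply/val_inj; rewrite /= linearP. Qed.

HB.instance Definition _ i :=
  GRing.isLinear.Build K (polyle n K d) (polyle n K d) _ (derivp i)
    (derivp_is_linear i).

Definition partial (i : 'I_n) : 'End(polyle n K d) := linfun (derivp i).

End Apolar.

Arguments eval_at {n K d} l.
Arguments partial {n K d} i.

Definition affine n (K : fieldType) (l : 'I_n -> K) : {mpoly K[n]} :=
  1 + \sum_(i < n) l i *: 'X_i.

Lemma affine_le n (K : fieldType) (l : 'I_n -> K) : affine l \is deg_le n K 1.
Proof.
apply: rpredD; first by rewrite unfold_in /deg_le_pred msize1.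
apply: rpred_sum => i _; apply: rpredZ.
by rewrite unfold_in /deg_le_pred msizeX mdeg1.
Qed.

Lemma deg_leM n (K : fieldType) a b (p q : {mpoly K[n]}) :
  p \is deg_le n K a -> q \is deg_le n K b -> p * q \is deg_le n K (a + b).
Proof.
rewrite !unfold_in /deg_le_pred.
have [->|p0] := eqVneq p 0; first by rewrite mul0r msize0.
have [->|q0] := eqVneq q 0; first by rewrite mulr0 msize0.
rewrite msizeM // -!mlead_deg // !ltnS addSn addnS /= => ha hb.
by rewrite ltnS leq_add.
Qed.

Lemma affine_powM_le n (K : fieldType) (l g : 'I_n -> K) d :
  (0 < d)%N -> affine l ^+ d.-1 * affine g \is deg_le n K d.
Proof.
case: d => // d _ /=; rewrite -[d.+1]addn1.
apply: deg_leM (affine_le g); elim: d => [|d IH].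
  by rewrite expr0 unfold_in /deg_le_pred msize1.
by rewrite exprS -add1n; apply: deg_leM (affine_le l) IH.
Qed.

(* Main.v *)
(** Pairing with f divides the coefficient of x^m by binom(d, m), i.e. multiplies
    it by w_d(m)/d! with w_d(m) = m! (d-|m|)!.  Since
    w_(d+1)(m) = (d+1-|m|) w_d(m) = m_i w_d(m - e_i),
    multiplying by g a polynomial whose weighted coefficients are c l^m gives
    weighted coefficients c ((d+1-|m|) l^m + sum_i g_i m_i l^(m-e_i)).
    For g = l the bracket is (d+1) l^m, which computes the powers of l by
    induction; one more step with a general g computes l^(d-1) g, and the Euler
    identity sum_i l_i m_i l^(m-e_i) = |m| l^m yields the formula. *)

Require Import Defs.
From mathcomp Require Import all_boot all_algebra ring.

Import GRing.Theory.
Local Open Scope ring_scope.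

(** The sum is restricted to [m i != 0] because monomial subtraction truncates: for [m i = 0],
    [m - U_(i)] is [m] itself and would contribute a spurious term. *)
Lemma mcoeffM_affine {n} {K : fieldType} (p : {mpoly K[n]}) (g : 'I_n -> K)
    (m : 'X_{1..n}) :
  (p * affine g)@_m =
  p@_m + \sum_(i < n | m i != 0%N) g i * p@_(m - U_(i))%MM.
Proof.
rewrite mulrDr mulr1 mcoeffD mulr_sumr raddf_sum /=; congr (_ + _).
rewrite [RHS]big_mkcond; apply: eq_bigr => i _.
rewrite -scalerAr mcoeffZ; case: ifPn => mi.
  by rewrite -{1}(submK (m := U_(i)%MM) (m' := m)) ?lep1mP // addmC mcoeffMX.
(* A nonzero coefficient would put [m] in the support of [p * 'X_i], forcing [m i > 0]. *)
have [->|] := eqVneq (p * 'X_i)@_m 0; first by rewrite mulr0.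
rewrite -mcoeff_msupp => /msuppM_le /allpairsP[[m1 m2] /= [_]].
rewrite msuppX inE => /eqP-> def_m; case/negP: mi.
by rewrite def_m mnmDE mnm1E eqxx addn1.
Qed.

Lemma mdeg_subU {n} {m : 'X_{1..n}} {i : 'I_n} :
  m i != 0%N -> mdeg m = (mdeg (m - U_(i))%MM).+1.
Proof.
move=> mi; rewrite -{1}(submK (m := U_(i)%MM) (m' := m)) ?lep1mP //.
by rewrite mdegD mdeg1 addn1.
Qed.

(** The factor [m i] kills both sides in the truncated case, so no side condition appears. *)
Lemma mulr_mevalX_subU {n} {K : fieldType} (l : 'I_n -> K) (m : 'X_{1..n}) i :
  (m i)%:R * l i * ('X_[(m - U_(i))]).@[l] = (m i)%:R * ('X_[m]).@[l].
Proof.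
have [->|mi] := eqVneq (m i) 0%N; first by rewrite !mul0r.
have -> : 'X_[m] = 'X_[(m - U_(i))] * 'X_i :> {mpoly K[n]}.
  by rewrite -mpolyXD submK ?lep1mP.
by rewrite mevalM mevalXU -mulrA [l i * _]mulrC.
Qed.

(* [d! / multibinom d m], meant for [mdeg m <= d]: the subtraction truncates. *)
Definition binom_weight {n} (d : nat) (m : 'X_{1..n}) : nat :=
  ((\prod_(i < n) (m i)`!) * (d - mdeg m)`!)%N.

Lemma binom_weight_subU {n} {d} {m : 'X_{1..n}} {i} : m i != 0%N ->
  binom_weight d.+1 m = (m i * binom_weight d (m - U_(i))%MM)%N.
Proof.
move=> mi; rewrite /binom_weight (mdeg_subU mi) subSS.
rewrite (bigD1 i) //= [in RHS](bigD1 i) //= mnmBE mnm1E eqxx subn1.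
have -> : (m i)`! = (m i * (m i).-1`!)%N
  by case: (m i) mi => // k; rewrite factS.
rewrite !mulnA; congr (_ * _ * _)%N; apply: eq_bigr => j ji.
by rewrite mnmBE mnm1E eq_sym (negbTE ji) subn0.
Qed.

Lemma binom_weightS {n d} {m : 'X_{1..n}} : (mdeg m <= d)%N ->
  binom_weight d.+1 m = ((d.+1 - mdeg m) * binom_weight d m)%N.
Proof. by move=> md; rewrite /binom_weight subSn // factS mulnCA. Qed.

Lemma mcoeffM_affine_weight {n} {K : fieldType} (l g : 'I_n -> K) {d}
    {p : {mpoly K[n]}} {c : K} : (msize p <= d.+1)%N ->
  (forall m, (mdeg m <= d)%N ->
     p@_m * (binom_weight d m)%:R = c * ('X_[m]).@[l]) ->
  forall m, (mdeg m <= d.+1)%N ->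
  (p * affine g)@_m * (binom_weight d.+1 m)%:R =
  c * ((d.+1 - mdeg m)%:R * ('X_[m]).@[l] +
       \sum_(i < n) (m i)%:R * g i * ('X_[(m - U_(i))]).@[l]).
Proof.
move=> sp hp m md; rewrite mcoeffM_affine mulrDl mulrDr; congr (_ + _).
  case: (leqP (mdeg m) d) => [md'|md'].
    by rewrite binom_weightS // natrM mulrCA hp // mulrCA.
  (* In the top degree [d.+1], [hp] says nothing, but both sides vanish: the left by the degree
     bound on [p], the right through the factor [d.+1 - mdeg m]. *)
  have -> : p@_m = 0 by apply/memN_msupp_eq0/msize_mdeg_ge/(leq_trans sp).
  by have /eqP-> : (d.+1 - mdeg m == 0)%N; rewrite ?subn_eq0 ?mul0r ?mulr0.
rewrite mulr_suml mulr_sumr big_mkcond; apply: eq_bigr => i _.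
case: ifPn => [mi|]; last by rewrite negbK => /eqP->; rewrite !mul0r mulr0.
rewrite (binom_weight_subU mi) natrM mulrACA hp.
  by rewrite [g i * _]mulrC mulrCA.
by rewrite -ltnS -(mdeg_subU mi).
Qed.

Lemma affine_pow_le {n} {K : fieldType} (l : 'I_n -> K) d :
  (msize (affine l ^+ d) <= d.+1)%N.
Proof.
elim: d => [|d IH]; first by rewrite expr0 msize1.
by have := deg_leM (affine_le l) IH; rewrite -exprS add1n.
Qed.

Lemma sum_mulr_mevalX_subU {n} {K : fieldType} (l : 'I_n -> K) (m : 'X_{1..n}) :
  \sum_(i < n) (m i)%:R * l i * ('X_[(m - U_(i))]).@[l] =
  (mdeg m)%:R * ('X_[m]).@[l].
Proof.
rewrite mdegE natr_sum mulr_suml; apply: eq_bigr => i _.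
exact: mulr_mevalX_subU.
Qed.

Lemma mcoeff_affine_pow_weight {n} {K : fieldType} (l : 'I_n -> K) d
    (m : 'X_{1..n}) : (mdeg m <= d)%N ->
  (affine l ^+ d)@_m * (binom_weight d m)%:R = d`!%:R * ('X_[m]).@[l].
Proof.
elim: d m => [|d IH] m md.
  move: md; rewrite leqn0 mdeg_eq0 => /eqP->.
  rewrite expr0 mcoeff1 eqxx mpolyX0 meval1 /binom_weight mdeg0 big1 //.
  by move=> i _; rewrite mnm0E.
rewrite exprSr (mcoeffM_affine_weight l l (affine_pow_le l d) IH) //.
(* By Euler's identity the bracket has total factor [(d.+1 - mdeg m) + mdeg m = d.+1], which turns
   [d!] into [(d.+1)!]. *)
by rewrite sum_mulr_mevalX_subU -mulrDl -natrD subnK // factS natrM mulrA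
           [d.+1%:R * _]mulrC.
Qed.

Lemma eval_atE {n} {K : fieldType} {d} (l : 'I_n -> K) (f : polyle n K d) :
  eval_at l f =
  \sum_(m : 'X_{1..n < d.+1}) (f : {mpoly K[n]})@_m * ('X_[m]).@[l].
Proof.
rewrite lfunE /= /evalp [in LHS](mpolywE (polyle_size f)) raddf_sum /=.
by apply: eq_bigr => m _; rewrite mevalZ.
Qed.

Lemma eval_at_partialE {n} {K : fieldType} {d} (l : 'I_n -> K) i
    (f : polyle n K d) :
  eval_at l (partial i f) = \sum_(m : 'X_{1..n < d.+1})
    (f : {mpoly K[n]})@_m * ((m i)%:R * ('X_[(m - U_(i))]).@[l]).
Proof.
rewrite lfunE /= lfunE /evalp /= (mderivwE i (polyle_size f)) raddf_sum /=.
by apply: eq_bigr => m _; rewrite mevalZ mulrA [(m i)%:R * _]mulrC.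
Qed.

Theorem proposition5p1 (K : closedFieldType) (charK : [pchar K] =i pred0)
    (n : nat) (n_gt0 : (0 < n)%N) (l g : 'I_n -> K) (d : nat)
    (d_gt0 : (0 < d)%N) :
  tau (PolyLe (affine_powM_le l g d_gt0)) =
  eval_at l + d%:R^-1 *:
    (eval_at l \o \sum_(i < n) (g i - l i) *: partial i)%VF.
Proof.
have nat0 k : (0 < k)%N -> k%:R != 0 :> K.
  by have /pcharf0P-> := charK; rewrite lt0n.
(* Evaluated at [f], both sides become sums over the monomials of degree at most [d], compared term
   by term. *)
apply/lfunP => f; rewrite add_lfunE scale_lfunE comp_lfunE sum_lfunE linear_sum.
under eq_bigr => i _ do
  rewrite scale_lfunE linearZ_LR /= eval_at_partialE [_ *: _]mulr_sumr.
rewrite exchange_big eval_atE [_ *: _]mulr_sumr -big_split lfunE.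
apply: eq_bigr => m _ /=.
have md : (mdeg m <= d)%N by rewrite -ltnS bmdeg.
set fm := (f : {mpoly K[n]})@_m.
rewrite /multibinom invf_div -/(binom_weight d m).
case: d d_gt0 f m md @fm => // d d_gt0 f m md fm; rewrite -pred_Sn.
have coef_weight := mcoeffM_affine_weight l g (affine_pow_le l d)
  (mcoeff_affine_pow_weight l d) _ md.
rewrite mulrAC mulrA coef_weight natrB // factS natrM.
set X := ('X_[m]).@[l].
(* Euler's identity evaluates the [l i] part, so that its [- mdeg m] matches the one in
   [d.+1 - mdeg m]. *)
have -> : \sum_(i < n) (g i - l i) * (fm * ((m i)%:R * ('X_[(m - U_(i))]).@[l]))
    = fm * (\sum_(i < n) (m i)%:R * g i * ('X_[(m - U_(i))]).@[l]
            - (mdeg m)%:R * X).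
  rewrite -sum_mulr_mevalX_subU -sumrB mulr_sumr.
  by apply: eq_bigr => i _; ring.
field.
(* Characteristic zero makes the denominators [d.+1] and [d!] nonzero. *)
by rewrite nat1r !nat0 ?fact_gt0.
Qed.
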